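(* Suppose that for every pair of consecutive primes $p_{k-1}<p_k$ such that $p_k$ is a Legendre prime, the inequality $\sqrt{p_k}-\sqrt{p_{k-1}}<1$ holds. Then for every integer $n\ge2$ there is a prime $p$ with $(n-1)^2<p<n^2$.
   Context: $p_1=2,p_2=3,\dots$ denotes the sequence of primes in increasing order. A prime $p$ is called a Legendre prime if there is an integer $a\ge1$ such that $p$ is the smallest prime greater than $a^2$; the Legendre primes are $2,5,11,17,29,37,53,\dots$. *)

(* Defs.v *)
From mathcomp Require Import all_boot all_order all_algebra.
From mathcomp Require Import reals.

Lemma next_prime_subproof (m : nat) : exists p, prime p && (m < p).
Proof. by have [p lt_mp p_pr] := prime_above m; exists p; rewrite p_pr. Qed.

Definition next_prime (m : nat) : nat := ex_minn (next_prime_subproof m).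

(* 1-indexed: nth_prime 1 = 2, nth_prime 2 = 3, ...; nth_prime 0 = 0 is a
   junk value. *)
Definition nth_prime (k : nat) : nat := iter k next_prime 0.

Definition legendre_prime (p : nat) : Prop :=
  exists a : nat, 1 <= a /\ p = next_prime (a ^ 2).

(* Main.v *)
Require Import Defs.
From mathcomp Require Import all_boot all_order all_algebra.
From mathcomp Require Import reals.

(** With [a = n - 1 >= 2], let [q <= a ^ 2] be the largest prime up to [a ^ 2]
    and [p] the next one.  Then [p] is a Legendre prime with predecessor [q],
    so [sqrt p < 1 + sqrt q <= 1 + a = n]. *)

Import Order.TTheory GRing.Theory Num.Theory.

Lemma next_prime_prime m : prime (next_prime m).
Proof. by rewrite /next_prime; case: ex_minnP => p /andP[]. Qed.

Lemma next_prime_gt m : m < next_prime m.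
Proof. by rewrite /next_prime; case: ex_minnP => p /andP[]. Qed.

Lemma next_prime_min m p : prime p -> m < p -> next_prime m <= p.
Proof.
move=> p_pr lt_mp; rewrite /next_prime; case: ex_minnP => q _; apply.
by rewrite p_pr.
Qed.

(** Induction on [m]: the index moves up exactly when [m.+1] reaches the upper prime. The junk value
    [nth_prime 0 = 0] serves as lower end for [m < 2]. *)
Lemma nth_prime_bracket m : exists k, nth_prime k <= m < nth_prime k.+1.
Proof.
elim: m => [|m [k /andP[le_km]]]; first by exists 0; exact: next_prime_gt.
rewrite leq_eqVlt => /orP[/eqP def_m | lt_m].
  by exists k.+1; rewrite def_m leqnn; exact: next_prime_gt.
by exists k; rewrite ltnW.
Qed.

(** Each side is a prime that competes in the other's minimality: [next_prime m] also exceeds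
    [nth_prime k]. *)
Lemma next_prime_nth_prime m k :
  nth_prime k <= m < nth_prime k.+1 -> next_prime m = nth_prime k.+1.
Proof.
case/andP=> le_km lt_mk; apply/eqP; rewrite eqn_leq.
rewrite next_prime_min //=; last exact: next_prime_prime.
rewrite next_prime_min ?next_prime_prime //.
exact: leq_ltn_trans (next_prime_gt m).
Qed.

Lemma sqrt_natr_sqr (R : rcfType) (a : nat) :
  Num.sqrt ((a ^ 2)%:R : R)%R = a%:R%R.
Proof. by rewrite natrX sqrtr_sqr normr_nat. Qed.

Theorem theorem19 (R : realType)
  (H : forall k : nat, 2 <= k -> legendre_prime (nth_prime k) ->
     (Num.sqrt ((nth_prime k)%:R : R) - Num.sqrt ((nth_prime (k - 1))%:R : R)
        < 1)%R) :
  forall n : nat, 2 <= n ->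
    exists p : nat, prime p /\ (n - 1) ^ 2 < p /\ p < n ^ 2.
Proof.
(* For [n = 2] the prime after 1 is [nth_prime 1], outside the range [2 <= k] of [H]. *)
case=> [|[|[|n]]] // _; first by exists 2.
rewrite subn1 /=; set a := n.+2.
exists (next_prime (a ^ 2)); split; first exact: next_prime_prime.
split; first exact: next_prime_gt.
have [k hk] := nth_prime_bracket (a ^ 2).
have def_p := next_prime_nth_prime _ _ hk.
case/andP: hk => le_qa lt_ap.
have k_gt0 : 0 < k.
  (* If [k = 0], then [a ^ 2 < nth_prime 1 <= 2], but [a >= 2] gives [4 <= a ^ 2]. *)
  case: k lt_ap {def_p le_qa} => // lt_ap.
  have := leq_trans lt_ap (next_prime_min 0 2 isT isT).
  by rewrite ltnNge (@leq_trans (2 ^ 2)) // leq_sqr.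
have lt_gap : (Num.sqrt ((nth_prime k.+1)%:R : R)
               - Num.sqrt ((nth_prime k)%:R : R) < 1)%R.
  by have := H k.+1 k_gt0; rewrite subn1; apply; exists a.
rewrite def_p -(ltr_nat R) -ltr_sqrt; last by rewrite ltr0n.
rewrite sqrt_natr_sqr -natr1 addrC -ltrBlDr.
(* After taking roots the goal is [sqrt p - a < 1]; replacing [a] by [sqrt q <= a] only enlarges the
   left side. *)
apply: le_lt_trans lt_gap; rewrite lerD2l lerN2 -sqrt_natr_sqr.
by rewrite ler_wsqrtr // ler_nat.
Qed.
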